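(* For $\alpha\in\mathbb{N}_0$, $\lambda,\eta,\delta\in\mathbb{C}$ and $n\in\mathbb{N}$, the following relation holds: $${}_{\mathfrak{B}}\mathcal{F}_n^{(\alpha)}(x_1,x_2;\lambda;\eta,\delta)=\sum_{k=0}^{n}\binom{n}{k}\,{}_{\mathfrak{B}}\mathcal{F}_k^{(\alpha)}(x_2;\lambda;\eta,\delta)\,x_1^{\,n-k}.$$
   Context: $\mathbb{N}$ is the set of natural numbers, $\mathbb{N}_0$ the set of non-negative integers, $\mathbb{C}$ the set of complex numbers; $x_1,x_2$ are variables. For $\alpha\in\mathbb{N}_0$ and $\lambda,\eta,\delta\in\mathbb{C}$, the Bell based Apostol type polynomials ${}_{\mathfrak{B}}\mathcal{F}_n^{(\alpha)}(x_1,x_2;\lambda;\eta,\delta)$ of order $\alpha$ are defined by the generating function $$\sum_{n\ge 0}{}_{\mathfrak{B}}\mathcal{F}_n^{(\alpha)}(x_1,x_2;\lambda;\eta,\delta)\frac{t^n}{n!}=\left(\frac{2^{\eta}t^{\delta}}{\lambda e^{t}+1}\right)^{\alpha}e^{x_1t+x_2(e^t-1)},\qquad |t|<|\log(-\lambda)|.$$ The one-variable notation ${}_{\mathfrak{B}}\mathcal{F}_n^{(\alpha)}(x_2;\lambda;\eta,\delta)$ stands for ${}_{\mathfrak{B}}\mathcal{F}_n^{(\alpha)}(0,x_2;\lambda;\eta,\delta)$, i.e. $$\sum_{n\ge 0}{}_{\mathfrak{B}}\mathcal{F}_n^{(\alpha)}(x_2;\lambda;\eta,\delta)\frac{t^n}{n!}=\left(\frac{2^{\eta}t^{\delta}}{\lambda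 e^{t}+1}\right)^{\alpha}e^{x_2(e^t-1)}.$$ *)

(* Defs.v *)
From mathcomp Require Import all_boot all_order all_algebra.
From mathcomp Require Import complex.
From mathcomp Require Import all_classical all_reals all_analysis.

Set Implicit Arguments.
Unset Strict Implicit.
Unset Printing Implicit Defensive.

Import Order.TTheory GRing.Theory Num.Theory.
Import numFieldNormedType.Exports.

Local Open Scope classical_set_scope.
Local Open Scope ring_scope.
Local Open Scope complex_scope.

(* Typing complex numbers in the [numClosedFieldType] structure of [R[i]],
   rather than in [R[i]] itself, gives access to the topology that
   MathComp-Analysis puts on every [numClosedFieldType]. *)
Definition Cplx (R : realType) : numClosedFieldType := R[i].

Definition cexp (R : realType) (z : Cplx R) : Cplx R :=
  (expR (complex.Re z) * cos (complex.Im z))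
    +i* (expR (complex.Re z) * sin (complex.Im z)).

(* Principal determination of the argument, in ]-pi, pi] (for z != 0). *)
Definition carg (R : realType) (z : Cplx R) : R :=
  let theta := acos (complex.Re z / complex.Re `|z|) in
  if 0 <= complex.Im z then theta else - theta.

Definition clog (R : realType) (z : Cplx R) : Cplx R :=
  ln (complex.Re `|z|) +i* carg z.

(* z ^ w for z != 0. *)
Definition cpow (R : realType) (z w : Cplx R) : Cplx R := cexp (w * clog z).

(* The disc |t| < |log(- lambda)|.  For lambda != 0, -1 its radius is the least
   modulus of a zero of lambda e^t + 1.  The two values of lambda at which
   that reading degenerates follow the usual conventions: for lambda = 0 there
   is no zero, and the disc is the whole plane; for lambda = -1 (the
   Apostol-Bernoulli case) the zero at the origin is discarded, and the radius
   is the least modulus of the other zeros, 2 pi. *)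
Definition gf_disc (R : realType) (lambda t : Cplx R) : bool :=
  if lambda == 0 then true
  else if lambda == -1 then `|t| < ((pi *+ 2 : R)%:C : Cplx R)
  else `|t| < `|clog (- lambda)|.

Definition bell_apostol_gf (R : realType) (alpha : nat)
    (lambda eta delta x1 x2 t : Cplx R) : Cplx R :=
  (cpow 2 eta * cpow t delta / (lambda * cexp t + 1)) ^+ alpha
    * cexp (x1 * t + x2 * (cexp t - 1)).

(* The point t = 0, where t ^ delta is not defined in general and where the
   denominator vanishes if lambda = -1, is left out: there the generating
   function is understood as its limit. *)
Definition bell_apostol_expansion (R : realType) (alpha : nat)
    (lambda eta delta x1 x2 : Cplx R) (a : nat -> Cplx R) : Prop :=
  forall t : Cplx R, t != 0 -> gf_disc lambda t ->
    series (fun n => a n * (t ^+ n / n`!%:R)) @ \oo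
      --> bell_apostol_gf alpha lambda eta delta x1 x2 t.

(* The sequence of coefficients of the expansion, which is unique if it exists;
   when the generating function has no such expansion (e.g. alpha = 1 and
   delta = 1/2), the value is 0 by convention. *)
Definition bell_apostol (R : realType) (n alpha : nat)
    (x1 x2 lambda eta delta : Cplx R) : Cplx R :=
  xget (fun=> 0)
    [set a | bell_apostol_expansion alpha lambda eta delta x1 x2 a] n.

Definition bell_apostol1 (R : realType) (n alpha : nat)
    (x2 lambda eta delta : Cplx R) : Cplx R :=
  bell_apostol n alpha 0 x2 lambda eta delta.

(* Main.v *)
Require Import Defs.
From mathcomp Require Import all_boot all_order all_algebra.
From mathcomp Require Import complex.
From mathcomp Require Import all_classical all_reals all_analysis.
From mathcomp Require Import ring.

Import Order.TTheory GRing.Theory Num.Theory.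
Import numFieldNormedType.Exports.

(** Replacing [0] by [x1] multiplies the generating function by [exp (x1 t)]
    ([bell_apostol_gfD]), so the coefficients for [x1] should be the binomial
    convolution of those for [0] with the powers of [x1].  Since the polynomials
    are the coefficients of an expansion that is only known to converge pointwise
    on a punctured disc, and that may fail to exist, three facts are needed.

    - Products.  An expansion convergent on the open disc converges absolutely
      there ([bell_apostol_expansion_abs_summable], by comparison with a
      geometric series), and so does the exponential series; the Cauchy product
      of two absolutely convergent series converges to the product of the sums
      ([cvg_cauchy_prod]).  That the function [cexp], defined from [expR], [cos]
      and [sin], is the sum of the exponential series is [cvg_series_cexp].
      Hence an expansion at [y] yields one at [y + x]
      ([bell_apostol_expansionD]).

    - Uniqueness.  The punctured disc is nonempty for every [lambda]: its radius
      vanishes only if [clog (- lambda) = 0], which forces [lambda = -1], a value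
      for which the radius is [2 pi].  A power series that vanishes at points
      [q s] with [0 < q <= 1] has zero coefficients ([power_series_eq0]).

    - Existence.  If there is no expansion for [x1 = 0], then there is none for
      any [x1], because multiplying by [exp (- x1 t)] would lead back to [0].
      Both sides of the identity are then [0]. *)

Local Open Scope ring_scope.

(** * Cauchy products of absolutely convergent series *)

(** The coefficients of the product of two formal series. *)
Definition cauchy_prod {K : pzSemiRingType} (u v : nat -> K) (n : nat) : K :=
  \sum_(i < n.+1) u i * v (n - i)%N.

(** Absolute convergence, stated as boundedness of the partial sums of the norms:
    over a general numeric field, which need not be complete, this can be
    weaker than convergence of the series of norms. *)
Definition abs_summable {K : numFieldType} (u : nat -> K) : Prop :=
  exists M : K, forall n, series (fun k => `|u k|) n <= M.

Lemma series_cauchy_prod {K : numFieldType} (u v : nat -> K) (n : nat) :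
  series (cauchy_prod u v) n = \sum_(i < n) u i * series v (n - i)%N.
Proof.
elim: n => [|n IHn]; first by rewrite /series /= big_nil big_ord0.
rewrite seriesSr IHn [RHS]big_ord_recr /= subSnn.
under [in RHS]eq_bigr => i _ do rewrite subSn 1?ltnW// seriesSr mulrDr.
rewrite big_split /= -addrA; congr (_ + _).
by rewrite /cauchy_prod big_ord_recr /= subnn /series /= big_nat1.
Qed.

(** The terms [u i * v j] missing from the [n]-th partial sum of the Cauchy
    product have [i, j < n] and [i + j >= n]; their norms all occur in the Cauchy
    product of the norms between the indices [n] and [n + n]. *)
Lemma norm_cauchy_prod_tail {K : numFieldType} (u v : nat -> K) (n : nat) :
  `|series u n * series v n - series (cauchy_prod u v) n|
    <= series (cauchy_prod (fun k => `|u k|) (fun k => `|v k|)) (n + n)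
       - series (cauchy_prod (fun k => `|u k|) (fun k => `|v k|)) n.
Proof.
set w := cauchy_prod (fun k => `|u k|) (fun k => `|v k|).
set u' := fun k => `|u k|; set v' := fun k => `|v k|.
have sv' (m p : nat) : (m <= p)%N ->
    `|series v p - series v m| <= series v' p - series v' m.
  by move=> mp; rewrite !sub_series_geq//; exact: ler_norm_sum.
apply: (@le_trans _ _ (series u' n * series v' n - series w n)).
  rewrite !series_cauchy_prod.
  rewrite [in leLHS]/series/= [in leRHS]/series/= !big_mkord !mulr_suml -!sumrB.
  apply: le_trans (ler_norm_sum _ _ _) _; apply: ler_sum => i _.
  rewrite -!mulrBr normrM ler_wpM2l//.
  have := sv' (n - i)%N n (leq_subr _ _).
  by rewrite /series/= !big_mkord.
rewrite lerD2r series_cauchy_prod.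
rewrite [in leLHS]/series/= big_mkord mulr_suml big_split_ord/=.
have v'_ge0 m p : (m <= p)%N -> series v' m <= series v' p.
  by move=> mp; rewrite -subr_ge0; exact: le_trans (sv' _ _ mp).
apply: ler_wpDr.
  apply: sumr_ge0 => i _; rewrite mulr_ge0// ?normr_ge0//.
  by rewrite /series/= sumr_ge0// => k _; exact: normr_ge0.
apply: ler_sum => i _; rewrite ler_wpM2l ?normr_ge0//.
have ni : (n <= n + n - i)%N by rewrite -addnBA ?leq_addr// ltnW.
by have := v'_ge0 _ _ ni; rewrite [in X in X <= _]/series/= big_mkord.
Qed.

(** The partial sums are real numbers, so that the completeness of [R], by way of
    monotone convergence, applies to them. *)
Lemma abs_summable_cauchy_tail {R : realType} (w : nat -> Cplx R) (M : Cplx R) :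
  (forall n, 0 <= w n) -> (forall n, series w n <= M) ->
  (series w (n + n)%N - series w n @[n --> \oo] --> (0 : Cplx R))%classic.
Proof.
move=> w0 wM.
pose r n : R := complex.Re (series w n).
have s0 n : 0 <= series w n by rewrite /series/= sumr_ge0.
have rE n : series w n = (r n)%:C%C by rewrite /r RRe_real// ger0_real.
have M0 : 0 <= M by exact: le_trans (s0 0%N) (wM 0%N).
have ME : M = (complex.Re M)%:C%C by rewrite RRe_real// ger0_real.
have rnd : nondecreasing_seq r.
  move=> m p mp; rewrite -lecR -!rE -subr_ge0 sub_series_geq//.
  by rewrite sumr_ge0.
have cr : cvgn r.
  apply: nondecreasing_is_cvgn => //; exists (complex.Re M) => _ [n _ <-].
  by rewrite -lecR -rE -ME.
have /cvgrPdist_lt cr' : (r n @[n --> \oo] --> limn r)%classic by exact: cr.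
apply/cvgrPdist_lt => e e0.
have eE : e = (complex.Re e)%:C%C by rewrite RRe_real// gtr0_real.
have e0' : 0 < complex.Re e by rewrite -ltcR -eE.
near=> n.
rewrite sub0r normrN ger0_norm ?subr_ge0 ?rE ?lecR ?rnd ?leq_addr//.
rewrite -rmorphB/= eE ltcR.
apply: le_lt_trans (_ : limn r - r n < _).
  by rewrite lerB// nondecreasing_cvgn_le.
apply: le_lt_trans (ler_norm _) _.
by near: n; exact: cr'.
Unshelve. all: by end_near. Qed.

Lemma cvg_cauchy_prod {R : realType} (u v : nat -> Cplx R) (a b : Cplx R) :
  abs_summable u -> abs_summable v ->
  (series u @ \oo --> a -> series v @ \oo --> b ->
  series (cauchy_prod u v) @ \oo --> a * b)%classic.
Proof.
move=> [M uM] [N vN] ua vb.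
pose w := cauchy_prod (fun k => `|u k|) (fun k => `|v k|).
have w0 n : 0 <= w n by apply: sumr_ge0 => i _; rewrite mulr_ge0.
have M0 : 0 <= M by apply: le_trans (uM 0%N); rewrite /series/= sumr_ge0.
have wM n : series w n <= M * N.
  rewrite /w series_cauchy_prod.
  apply: le_trans (_ : series (fun k => `|u k|) n * N <= _); last first.
    rewrite ler_wpM2r ?uM//.
    by apply: le_trans (vN 0%N); rewrite /series/= sumr_ge0.
  rewrite /series/= big_mkord mulr_suml; apply: ler_sum => i _.
  by rewrite ler_wpM2l ?normr_ge0//; exact: vN.
have wc := abs_summable_cauchy_tail _ _ w0 wM.
have dc : (series (cauchy_prod u v) n - series u n * series v n
    @[n --> \oo] --> (0 : Cplx R))%classic.
  apply/cvgrPdist_lt => e e0; near=> n.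
  rewrite sub0r normrN distrC.
  apply: le_lt_trans (norm_cauchy_prod_tail u v n) _.
  apply: le_lt_trans (real_ler_norm _) _.
    rewrite ger0_real// subr_ge0 -subr_ge0 sub_series_geq ?leq_addr//.
    by apply: sumr_ge0 => k _; exact: w0.
  near: n; have /cvgrPdist_lt /(_ e e0) := wc.
  by apply: filterS => n; rewrite sub0r normrN.
have uvab : (series u n * series v n @[n --> \oo] --> a * b)%classic.
  exact: cvgM ua vb.
exact: cvg_sub0 dc uvab.
Unshelve. all: by end_near. Qed.

(** * The complex exponential series *)

(** Products of exponential generating functions are binomial convolutions. *)
Lemma cauchy_prod_fact (K : numFieldType) (a b : nat -> K) (n : nat) :
  cauchy_prod (fun k => a k / k`!%:R) (fun k => b k / k`!%:R) n =
  (\sum_(k < n.+1) 'C(n, k)%:R * a k * b (n - k)%N) / n`!%:R.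
Proof.
have f0 m : m`!%:R != 0 :> K by rewrite pnatr_eq0 -lt0n fact_gt0.
rewrite /cauchy_prod mulr_suml; apply: eq_bigr => -[k kn] _ /=.
have := @bin_fact n k kn => /(congr1 (fun m => m%:R : K)); rewrite !natrM => <-.
have c0 : 'C(n, k)%:R != 0 :> K by rewrite pnatr_eq0 -lt0n bin_gt0.
by field; rewrite c0 !f0.
Qed.

Lemma cauchy_prod_exp (K : numFieldType) (x y : K) :
  cauchy_prod (fun k => x ^+ k / k`!%:R) (fun k => y ^+ k / k`!%:R) =
  (fun n => (x + y) ^+ n / n`!%:R).
Proof.
apply/funext => n; rewrite cauchy_prod_fact; congr (_ / _).
rewrite addrC exprDn; apply: eq_bigr => k _.
by rewrite -mulrA mulr_natl [x ^+ k * _]mulrC.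
Qed.

Lemma cvg_real_complex {R : realType} (u : nat -> R) (l : R) :
  (u n @[n --> \oo] --> l ->
   ((u n)%:C%C : Cplx R) @[n --> \oo] --> (l%:C%C : Cplx R))%classic.
Proof.
move=> /cvgrPdist_lt ul; apply/cvgrPdist_lt => e e0.
have eE : e = (complex.Re e)%:C%C by rewrite RRe_real// gtr0_real.
have e0' : 0 < complex.Re e by rewrite -ltcR -eE.
near=> n.
rewrite -rmorphB/= normc_def/= [0 ^+ 2]expr0n addr0 sqrtr_sqr eE ltcR.
by near: n; exact: ul.
Unshelve. all: by end_near. Qed.

Lemma cexpD {R : realType} (z w : Cplx R) : cexp (z + w) = cexp z * cexp w.
Proof.
case: z w => [a b] [c d].
rewrite /cexp/= expRD cosD sinD; apply/eqP; rewrite eq_complex/=.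
by apply/andP; split; apply/eqP; ring.
Qed.

Lemma abs_summable_exp {R : realType} (z : Cplx R) :
  abs_summable (fun n => z ^+ n / n`!%:R).
Proof.
pose r : R := complex.Re `|z|.
have rE : `|z| = r%:C%C by rewrite /r RRe_real// normr_real.
have r0 : 0 <= r by rewrite -lecR -rE; exact: normr_ge0.
exists (expR r)%:C%C => n.
have -> : series (fun k => `|z ^+ k / k`!%:R|) n =
    (series (exp_coeff r) n)%:C%C.
  rewrite /series/= rmorph_sum; apply: eq_bigr => k _.
  rewrite normrM normfV normrX normr_nat rE.
  by rewrite rmorphM/= rmorphXn fmorphV rmorph_nat.
rewrite lecR; apply: nondecreasing_cvgn_le; last exact: is_cvg_series_exp_coeff.
move=> m p mp; rewrite -subr_ge0 sub_series_geq// sumr_ge0// => k _.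
by rewrite /exp_coeff/= divr_ge0// exprn_ge0.
Qed.

Lemma cvg_series_cexp_real {R : realType} (x : R) :
  (series (fun n => (x%:C%C : Cplx R) ^+ n / n`!%:R) @ \oo
    --> cexp x%:C%C)%classic.
Proof.
have -> : cexp x%:C%C = (expR x)%:C%C.
  by rewrite /cexp/= cos0 sin0 mulr1 mulr0.
have -> : series (fun n => (x%:C%C : Cplx R) ^+ n / n`!%:R) =
    (fun n => (series (exp_coeff x) n)%:C%C).
  apply/funext => n; rewrite /series/= rmorph_sum; apply: eq_bigr => k _.
  by rewrite rmorphM/= rmorphXn fmorphV rmorph_nat.
apply: cvg_real_complex; exact: is_cvg_series_exp_coeff.
Qed.

Lemma cvg_series_cexp_imag {R : realType} (y : R) :
  (series (fun n => (0 +i* y : Cplx R)%C ^+ n / n`!%:R) @ \oo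
    --> cexp (0 +i* y)%C)%classic.
Proof.
pose I : Cplx R := 'i%C.
have I2 : I * I = -1 by rewrite -expr2; exact: sqr_i.
(* The parity split matches the shape of [cos_coeff] and [sin_coeff]. *)
have IX k : I ^+ k = (~~ odd k)%:R * (-1) ^+ k./2
    + I * ((odd k)%:R * (-1) ^+ k.-1./2).
  rewrite -{1}(odd_double_half k) exprD -mul2n exprM [I ^+ 2]expr2 I2.
  case: (boolP (odd k)) => ok /=; last by rewrite expr0; ring.
  have -> : k.-1./2 = k./2 by rewrite -{1}(odd_double_half k) ok /= doubleK.
  by rewrite expr1; ring.
have aE (a b : R) : (a +i* b)%C = (a%:C%C + I * b%:C%C : Cplx R).
  by apply/eqP; rewrite eq_complex/=; apply/andP; split; apply/eqP; ring.
have -> : cexp (0 +i* y)%C = (cos y)%:C%C + I * (sin y)%:C%C.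
  by rewrite /cexp/= expR0 !mul1r -aE.
have -> : series (fun n => (0 +i* y : Cplx R)%C ^+ n / n`!%:R) =
    (fun n => (series (cos_coeff y) n)%:C%C
      + I * (series (sin_coeff y) n)%:C%C).
  apply/funext => n; rewrite /series/= !rmorph_sum mulr_sumr -big_split/=.
  apply: eq_bigr => k _.
  rewrite aE rmorph0 add0r exprMn IX /cos_coeff /sin_coeff/=.
  rewrite !rmorphM/= !fmorphV !rmorph_nat !rmorphXn rmorphN1/=.
  by ring.
have cvgc : (series (cos_coeff y) @ \oo --> cos y)%classic.
  by rewrite unlock; exact: is_cvg_series_cos_coeff.
have cvgs : (series (sin_coeff y) @ \oo --> sin y)%classic.
  by rewrite unlock; exact: is_cvg_series_sin_coeff.
apply: cvgD; first exact: cvg_real_complex.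
apply: cvgMl_tmp; exact: cvg_real_complex.
Qed.

Lemma cvg_series_cexp {R : realType} (z : Cplx R) :
  (series (fun n => z ^+ n / n`!%:R) @ \oo --> cexp z)%classic.
Proof.
case: z => x y.
have -> : (x +i* y)%C = x%:C%C + (0 +i* y)%C :> Cplx R.
  by apply/eqP; rewrite eq_complex/= addr0 add0r !eqxx.
rewrite cexpD -cauchy_prod_exp; apply: cvg_cauchy_prod.
- exact: abs_summable_exp.
- exact: abs_summable_exp.
- exact: cvg_series_cexp_real.
- exact: cvg_series_cexp_imag.
Qed.

(** * Power series *)

Lemma geometric_series_le (K : numFieldType) (q : K) (m n : nat) :
  0 <= q < 1 -> \sum_(m <= k < n) q ^+ k <= q ^+ m / (1 - q).
Proof.
move=> /andP[q0 q1]; have q1' : 0 < 1 - q by rewrite subr_gt0.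
rewrite ler_pdivlMr//.
have [nm|mn] := leqP n m; first by rewrite big_geq// mul0r exprn_ge0.
rewrite -(subnKC (ltnW mn)); elim: (n - m)%N => [|p IHp].
  by rewrite addn0 big_geq// mul0r exprn_ge0.
have -> : (\sum_(m <= k < m + p.+1) q ^+ k) * (1 - q) =
      q ^+ m - q ^+ (m + p.+1).
  elim: p.+1 => [|r IHr]; first by rewrite addn0 big_geq// mul0r subrr.
  by rewrite addnS big_nat_recr ?leq_addr//= mulrDl IHr exprSr; ring.
by rewrite gerBl exprn_ge0.
Qed.

Lemma cvg_series_bounded_terms (K : numFieldType) (u : nat -> K) :
  cvgn (series u) -> exists2 M : K, 0 < M & forall n, `|u n| <= M.
Proof.
move=> /cvg_series_cvg_0 u0.
have /cvg_seq_bounded/pinfty_ex_gt0[M M0 uM] := cvgP _ u0.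
by exists M => // n; exact: uM.
Qed.

Lemma abs_summable_power_series (K : numFieldType) (u : nat -> K) (q : K) :
  0 <= q < 1 -> cvgn (series u) -> abs_summable (fun n => u n * q ^+ n).
Proof.
move=> q01 /cvg_series_bounded_terms[M M0 uM].
have q0 : 0 <= q by case/andP: q01.
exists (M * (q ^+ 0 / (1 - q))) => n.
apply: le_trans (_ : M * \sum_(0 <= k < n) q ^+ k <= _); last first.
  by rewrite ler_pM2l//; exact: geometric_series_le.
rewrite /series/= mulr_sumr; apply: ler_sum => k _.
by rewrite normrM [`|q ^+ k|]ger0_norm ?exprn_ge0// ler_wpM2r ?exprn_ge0.
Qed.

(** If [c m] were the first nonzero coefficient, the term [c m * q ^+ m] would
    dominate the sum of the later ones, which is at most
    [M * q ^+ m.+1 / (1 - q)], for small [q]. *)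
Lemma power_series_eq0 (K : numFieldType) (c : nat -> K) :
  (forall q : K, 0 < q <= 1 ->
    (series (fun n => c n * q ^+ n) @ \oo --> (0 : K))%classic) ->
  forall n, c n = 0.
Proof.
move=> c0.
have [M M0 cM] : exists2 M : K, 0 < M & forall n, `|c n| <= M.
  apply: cvg_series_bounded_terms; apply: (cvgP (0 : K)).
  have := c0 1; rewrite ltr01 lexx => /(_ isT).
  by under eq_fun => n do rewrite expr1n mulr1.
elim/ltn_ind => m IHm.
apply/eqP/negPn/negP; rewrite -normr_gt0 => A0; set A := `|c m| in A0.
(* With this [q], both [q <= 4^-1] and [M * q <= A / 4] hold, and hence
   [M * (q / (1 - q)) <= A / 3]. *)
pose q := A / (4 * (A + M)).
have AM0 : 0 < A + M by exact: addr_gt0.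
have q0 : 0 < q by rewrite divr_gt0// mulr_gt0.
have q4 : q <= 4^-1.
  rewrite /q invfM mulrCA -[leRHS]mulr1 ler_pM2l ?invr_gt0//.
  by rewrite ler_pdivrMr// mul1r lerDl ltW.
have q1 : q < 1 by apply: le_lt_trans q4 _; rewrite invf_lt1// ltr1n.
have q1' : 0 < 1 - q by rewrite subr_gt0.
have Mq : M * (q / (1 - q)) < A.
  rewrite mulrA ltr_pdivrMr//.
  apply: (@le_lt_trans _ _ (A / 4)).
    rewrite /q mulrC -mulrA ler_pM2l// invfM -mulrA -[leRHS]mulr1.
    rewrite ler_pM2l ?invr_gt0//.
    by rewrite mulrC ler_pdivrMr// mul1r lerDr ltW.
  rewrite ltr_pM2l// ltrBrDl.
  apply: le_lt_trans (_ : 4^-1 + 4^-1 < 1); first by rewrite lerD2r.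
  have -> : 4^-1 + 4^-1 = 2^-1 :> K by field.
  by rewrite invf_lt1// ltr1n.
pose e := q ^+ m * (A - M * (q / (1 - q))).
have e0 : 0 < e by rewrite mulr_gt0 ?exprn_gt0// subr_gt0.
have /cvgrPdist_lt/(_ e e0)[N _ HN] :
    (series (fun n => c n * q ^+ n) @ \oo --> (0 : K))%classic.
  by apply: c0; rewrite q0 ltW.
have := HN (maxn N m.+1) (leq_maxl _ _); rewrite /= sub0r normrN.
rewrite /series/= (@big_cat_nat _ _ _ m.+1)//= ?leq_maxr// big_nat_recr//=.
rewrite big_nat_cond big1 ?add0r; last first.
  by move=> i /andP[/andP[_ im] _]; rewrite IHm// mul0r.
set S := \sum_(_ <= _ < _) _.
have SM : `|S| <= M * (q ^+ m.+1 / (1 - q)).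
  apply: le_trans (ler_norm_sum _ _ _) _.
  apply: le_trans (_ : M * \sum_(m.+1 <= k < maxn N m.+1) q ^+ k <= _);
    last first.
    by rewrite ler_pM2l//; apply: geometric_series_le; rewrite ltW.
  rewrite mulr_sumr; apply: ler_sum => k _.
  by rewrite normrM [`|q ^+ k|]gtr0_norm ?exprn_gt0// ler_pM2r ?exprn_gt0.
apply/negP; rewrite -real_leNgt ?normr_real ?(gtr0_real e0)//.
have -> : e = A * q ^+ m - M * (q ^+ m.+1 / (1 - q)) by rewrite /e exprS; ring.
apply: le_trans (_ : A * q ^+ m - `|S| <= _); first by rewrite lerB.
have -> : A * q ^+ m = `|c m * q ^+ m|.
  by rewrite normrM [`|q ^+ m|]gtr0_norm ?exprn_gt0.
by rewrite lerBlDr -[X in `|X| <= _](addrK S) ler_normB.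
Qed.

(** * The disc of the generating function *)

Lemma clog_eq0 {R : realType} (z : Cplx R) : z != 0 -> clog z = 0 -> z = 1.
Proof.
move=> z0 [lnz argz].
have rE : `|z| = (complex.Re `|z|)%:C%C by rewrite RRe_real// normr_real.
have r0 : 0 < complex.Re `|z| by rewrite -ltcR -rE normr_gt0.
have r1 : complex.Re `|z| = 1 by apply/eqP; rewrite -ln_eq0// lnz.
have acos0 : acos (complex.Re z) = 0.
  move: argz; rewrite /carg r1 divr1; case: ifP => // _ /eqP.
  by rewrite oppr_eq0 => /eqP.
have n1 : `|z| = 1 by rewrite rE r1.
have Re1 : complex.Re z = 1.
  rewrite -cos0 -acos0 acosK// in_itv/= -ler_norml -lecR.
  by rewrite -[X in _ <= X]n1; exact: normc_ge_Re.
have Im0 : complex.Im z = 0.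
  have /(congr1 (fun x => x ^+ 2)) := r1.
  rewrite normc_def/= sqr_sqrtr ?addr_ge0 ?sqr_ge0// Re1 expr1n => /eqP.
  by rewrite -[eqbRHS]addr0 (inj_eq (addrI _)) sqrf_eq0 => /eqP.
by case: z Re1 Im0 {z0 lnz argz rE r0 r1 acos0 n1} => a b /= -> ->.
Qed.

Lemma gf_disc_radius {R : realType} (lambda : Cplx R) : lambda != 0 ->
  exists2 rho : Cplx R, 0 < rho & forall t, gf_disc lambda t = (`|t| < rho).
Proof.
move=> l0; rewrite /gf_disc (negbTE l0).
have [l1|l1] := eqVneq lambda (-1).
  exists ((pi *+ 2 : R)%:C%C) => //.
  by rewrite ltcR mulrn_wgt0// pi_gt0.
exists `|clog (- lambda)| => //; rewrite normr_gt0.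
apply: contra l1 => /eqP /clog_eq0; rewrite oppr_eq0 => /(_ l0) <-.
by rewrite opprK.
Qed.

Lemma gf_disc_neq0 {R : realType} (lambda : Cplx R) :
  exists2 t, t != 0 & gf_disc lambda t.
Proof.
have [->|/gf_disc_radius[rho rho0 rhoE]] := eqVneq lambda 0.
  by exists 1; rewrite ?oner_neq0// /gf_disc eqxx.
exists (rho / 2); first by rewrite mulf_neq0 ?invr_eq0 ?pnatr_eq0// gt_eqF.
by rewrite rhoE gtr0_norm ?divr_gt0// gtr_pMr// invf_lt1// ltr1n.
Qed.

Lemma gf_disc_scale {R : realType} (lambda t q : Cplx R) :
  0 < q <= 1 -> gf_disc lambda t -> gf_disc lambda (q * t).
Proof.
move=> /andP[q0 q1].
have [->|/gf_disc_radius[rho rho0 rhoE]] := eqVneq lambda 0.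
  by rewrite /gf_disc eqxx.
rewrite !rhoE normrM gtr0_norm// => /le_lt_trans; apply.
by rewrite ler_piMl.
Qed.

Lemma gf_disc_open {R : realType} (lambda t : Cplx R) : gf_disc lambda t ->
  exists2 q, 0 < q < 1 & gf_disc lambda (t / q).
Proof.
have h0 : 0 < 2^-1 :> Cplx R by rewrite invr_gt0.
have h1 : 2^-1 < 1 :> Cplx R by rewrite invf_lt1// ltr1n.
have [->|/gf_disc_radius[rho rho0 rhoE]] := eqVneq lambda 0.
  by exists 2^-1; rewrite ?h0// /gf_disc eqxx.
rewrite rhoE => trho.
have tr1 : `|t| / rho < 1 by rewrite ltr_pdivrMr// mul1r.
have [tq q1] := midf_lt tr1.
have q0 : 0 < (`|t| / rho + 1) / 2.
  by rewrite (le_lt_trans _ tq)// divr_ge0// ltW.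
exists ((`|t| / rho + 1) / 2); first by rewrite q0.
rewrite rhoE normrM normfV [`|_ / 2|]gtr0_norm//.
by rewrite ltr_pdivrMr// mulrC -ltr_pdivrMr.
Qed.

(** * Expansions of the generating function *)

Lemma bell_apostol_gfD {R : realType} (alpha : nat)
    (lambda eta delta y x x2 t : Cplx R) :
  bell_apostol_gf alpha lambda eta delta (y + x) x2 t =
  bell_apostol_gf alpha lambda eta delta y x2 t * cexp (x * t).
Proof.
by rewrite /bell_apostol_gf -[RHS]mulrA -cexpD; congr (_ * cexp _); ring.
Qed.

Lemma bell_apostol_expansion_abs_summable {R : realType} (alpha : nat)
    (lambda eta delta x1 x2 : Cplx R) (a : nat -> Cplx R) (t : Cplx R) :
  bell_apostol_expansion alpha lambda eta delta x1 x2 a ->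
  t != 0 -> gf_disc lambda t ->
  abs_summable (fun n => a n * (t ^+ n / n`!%:R)).
Proof.
move=> aE t0 /gf_disc_open[q /andP[q0 q1] tq].
have q0' : q != 0 by rewrite gt_eqF.
have -> : (fun n => a n * (t ^+ n / n`!%:R)) =
    (fun n => a n * ((t / q) ^+ n / n`!%:R) * q ^+ n).
  apply/funext => n; rewrite -{1}(divfK q0' t) exprMn; ring.
apply: abs_summable_power_series; first by rewrite q1 ltW.
by apply: cvgP; apply: aE => //; rewrite mulf_neq0// invr_eq0.
Qed.

Lemma bell_apostol_expansionD {R : realType} (alpha : nat)
    (lambda eta delta y x x2 : Cplx R) (a : nat -> Cplx R) :
  bell_apostol_expansion alpha lambda eta delta y x2 a ->
  bell_apostol_expansion alpha lambda eta delta (y + x) x2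
    (fun n => \sum_(k < n.+1) 'C(n, k)%:R * a k * x ^+ (n - k)).
Proof.
move=> aE t t0 td; rewrite bell_apostol_gfD.
have -> : (fun n => (\sum_(k < n.+1) 'C(n, k)%:R * a k * x ^+ (n - k))
      * (t ^+ n / n`!%:R)) =
    cauchy_prod (fun n => a n * (t ^+ n / n`!%:R))
      (fun n => (x * t) ^+ n / n`!%:R).
  apply/funext => n.
  under [X in cauchy_prod X _]eq_fun => k do rewrite mulrA.
  rewrite cauchy_prod_fact mulrA; congr (_ / _).
  rewrite mulr_suml; apply: eq_bigr => -[k kn] _ /=.
  have -> : t ^+ n = t ^+ (n - k) * t ^+ k by rewrite -exprD subnK.
  by rewrite exprMn; ring.
apply: cvg_cauchy_prod; last exact: cvg_series_cexp.
- exact: bell_apostol_expansion_abs_summable aE t0 td.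
- exact: abs_summable_exp.
- exact: aE.
Qed.

Lemma bell_apostol_expansion_unique {R : realType} (alpha : nat)
    (lambda eta delta x1 x2 : Cplx R) (a b : nat -> Cplx R) :
  bell_apostol_expansion alpha lambda eta delta x1 x2 a ->
  bell_apostol_expansion alpha lambda eta delta x1 x2 b -> a = b.
Proof.
move=> aE bE; have [s s0 sd] := gf_disc_neq0 lambda.
have f0 m : m`!%:R != 0 :> Cplx R by rewrite pnatr_eq0 -lt0n fact_gt0.
suff c0 n : (a n - b n) * (s ^+ n / n`!%:R) = 0.
  apply/funext => n; apply/eqP; rewrite -subr_eq0; move/eqP: (c0 n).
  rewrite !mulf_eq0 invr_eq0 (negbTE (f0 n)) expf_eq0 (negbTE s0).
  by rewrite andbF !orbF.
move: n; apply: power_series_eq0 => q /andP[q0 q1].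
have qs0 : q * s != 0 by rewrite mulf_neq0// gt_eqF.
have qsd : gf_disc lambda (q * s) by apply: gf_disc_scale => //; rewrite q0.
move: (aE _ qs0 qsd) (bE _ qs0 qsd).
set g := bell_apostol_gf _ _ _ _ _ _ _ => ag bg.
have -> : series (fun n => (a n - b n) * (s ^+ n / n`!%:R) * q ^+ n) =
  (series (fun n => a n * ((q * s) ^+ n / n`!%:R))
    - series (fun n => b n * ((q * s) ^+ n / n`!%:R)))%R.
  apply/funext => n; rewrite fctE /series/= -sumrB; apply: eq_bigr => k _.
  by rewrite exprMn; ring.
rewrite -[X in (_ --> X)%classic](subrr g); exact: cvgB.
Qed.

Lemma bell_apostolE {R : realType} (alpha : nat)
    (lambda eta delta x1 x2 : Cplx R) (a : nat -> Cplx R) (n : nat) :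
  bell_apostol_expansion alpha lambda eta delta x1 x2 a ->
  bell_apostol n alpha x1 x2 lambda eta delta = a n.
Proof.
move=> aE; rewrite /bell_apostol.
rewrite (@xget_unique _ _
  [set a | bell_apostol_expansion _ _ _ _ _ _ a]%classic a)// => b bE.
exact: bell_apostol_expansion_unique bE aE.
Qed.

Lemma bell_apostol_eq0 {R : realType} (alpha : nat)
    (lambda eta delta x1 x2 : Cplx R) (n : nat) :
  (forall a, ~ bell_apostol_expansion alpha lambda eta delta x1 x2 a) ->
  bell_apostol n alpha x1 x2 lambda eta delta = 0.
Proof. by move=> noE; rewrite /bell_apostol xgetPN. Qed.

Theorem theorem2p3 (R : realType) (alpha : nat) (lambda eta delta : Cplx R)
    (n : nat) (hn : (0 < n)%N) (x1 x2 : Cplx R) :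
  bell_apostol n alpha x1 x2 lambda eta delta =
  \sum_(k < n.+1)
    'C(n, k)%:R * bell_apostol1 k alpha x2 lambda eta delta * x1 ^+ (n - k).
Proof.
have [[a aE]|noE] :=
  pselect (exists a, bell_apostol_expansion alpha lambda eta delta 0 x2 a).
  have := bell_apostol_expansionD _ _ _ _ _ x1 _ _ aE; rewrite add0r => bE.
  rewrite (bell_apostolE _ _ _ _ _ _ _ n bE); apply: eq_bigr => k _.
  by rewrite /bell_apostol1 (bell_apostolE _ _ _ _ _ _ _ k aE).
have noE0 b : ~ bell_apostol_expansion alpha lambda eta delta 0 x2 b.
  by move=> bE; apply: noE; exists b.
have noE1 b : ~ bell_apostol_expansion alpha lambda eta delta x1 x2 b.
  by move=> /bell_apostol_expansionD -/(_ (- x1)); rewrite subrr; exact: noE0.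
rewrite (bell_apostol_eq0 _ _ _ _ _ _ n noE1) big1// => k _.
by rewrite /bell_apostol1 (bell_apostol_eq0 _ _ _ _ _ _ k noE0) mulr0 mul0r.
Qed.
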